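(* Let $d\ge1$ and let $G$ be a concordance inducing distribution function. Then $\mathcal{P}^{\mathrm{B}}_d(1/2)\subseteq\mathcal{K}_G$; that is, a matrix $P\in[-1,1]^{d\times d}$ is $\kappa_G$-compatible if it is the correlation matrix of some $d$-dimensional random vector all of whose margins are $\mathrm{Bern}(1/2)$.
   Context: A distribution function $G$ on $\mathbb{R}$ is concordance inducing if it is the distribution function of a non-degenerate, symmetric (about some point) distribution with finite second moment. Its quantile function is $G^{-1}(p)=\inf\{x:G(x)\ge p\}$, $p\in(0,1)$. For $(X_1,X_2)$ with continuous margins $F_1,F_2$, $\kappa_G(X_1,X_2)=\rho(G^{-1}(F_1(X_1)),G^{-1}(F_2(X_2)))$ with $\rho$ Pearson's correlation. A matrix $P\in[-1,1]^{d\times d}$ is $\kappa_G$-compatible if there is a $d$-dimensional random vector $\boldsymbol{X}=(X_1,\dots,X_d)$ with continuous margins such that $P=(\kappa_G(X_i,X_j))_{i,j}$. $\mathcal{K}_G$ denotes the set of all $\kappa_G$-compatible $d\times d$ matrices. $\mathcal{P}^{\mathrm{B}}_d(1/2)$ denotes the set of all correlation matrices of $d$-dimensional random vectors $(B_1,\dots,B_d)$ with $B_j\sim\mathrm{Bern}(1/2)$ for all $j$. *)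

(* Defs.v *)
From HB Require Import structures.
From mathcomp Require Import all_boot all_order all_algebra.
From mathcomp Require Import all_classical all_reals all_analysis.

Set Implicit Arguments.
Unset Strict Implicit.
Unset Printing Implicit Defensive.

Import Order.TTheory GRing.Theory Num.Theory.
Import numFieldNormedType.Exports.

Local Open Scope classical_set_scope.
Local Open Scope ring_scope.

(* The law mu of a distribution function G is a Borel probability on R;
   symmetry about c is invariance of mu under the reflection x |-> 2c - x. *)
Definition concordance_inducing (R : realType) (G : R -> R) : Prop :=
  exists mu : probability R R,
    [/\ forall x : R, mu `]-oo, x]%classic = (G x)%:E,
        forall a : R, mu [set a] <> 1%E,
        exists c : R, forall A : set R, measurable A ->
          mu [set x | A (c *+ 2 - x)] = mu A
      & (\int[mu]_x (x ^+ 2)%:E < +oo)%E].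

(* Meaningful for 0 < p < 1.  At p = 0 and p = 1 the set may be unbounded below
   or empty and [inf] then takes a default value; for a continuous margin F of
   X, the value F X is almost surely in the open unit interval. *)
Definition quantile (R : realType) (G : R -> R) (p : R) : R :=
  inf [set x | p <= G x].

Definition correlation (disp : measure_display) (T : measurableType disp)
    (R : realType) (P : probability T R) (X Y : T -> R) : R :=
  fine (covariance P X Y) /
    (Num.sqrt (fine ('V_P[X])) * Num.sqrt (fine ('V_P[Y]))).

Definition margin (disp : measure_display) (T : measurableType disp)
    (R : realType) (P : probability T R) (X : {RV P >-> R}) (x : R) : R :=
  fine (cdf X x).

Definition kappa (disp : measure_display) (T : measurableType disp)
    (R : realType) (P : probability T R) (G : R -> R) (X Y : {RV P >-> R}) : R :=
  correlation P (fun t => quantile G (margin X (X t)))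
                (fun t => quantile G (margin Y (Y t))).

Definition kappa_compatible (R : realType) (G : R -> R) (d : nat) :
    set 'M[R]_d :=
  [set A : 'M[R]_d | (forall i j, -1 <= A i j <= 1) /\
    exists (disp : measure_display) (T : measurableType disp)
           (P : probability T R) (X : 'I_d -> {RV P >-> R}),
      (forall i, continuous (margin (X i))) /\
      A = \matrix_(i, j) kappa G (X i) (X j)].

Arguments kappa_compatible {R} G d _.

(* The library's Bernoulli law lives on bool; here it is transported to R along
   b |-> b%:R, so X is 0-1 valued only almost surely. *)
Definition has_bernoulli_law (disp : measure_display) (T : measurableType disp)
    (R : realType) (P : probability T R) (p : R) (X : {RV P >-> R}) : Prop :=
  forall A : set R, measurable A ->
    distribution P X A = bernoulli_prob p [set b : bool | A b%:R].

Definition bernoulli_correlation_matrices (R : realType) (p : R) (d : nat) :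
    set 'M[R]_d :=
  [set A : 'M[R]_d | exists (disp : measure_display) (T : measurableType disp)
                  (P : probability T R) (B : 'I_d -> {RV P >-> R}),
      (forall i, has_bernoulli_law p (B i)) /\
      A = \matrix_(i, j) correlation P (B i) (B j)].

Arguments bernoulli_correlation_matrices {R} p d _.

(* Main.v *)
From HB Require Import structures.
Require Import Defs.
From mathcomp Require Import all_boot all_order all_algebra.
From mathcomp Require Import all_classical all_reals all_analysis.
From mathcomp Require Import measurable_realfun lebesgue_measure ring lra.
Import Order.TTheory GRing.Theory Num.Theory.
Import numFieldNormedType.Exports.
Local Open Scope classical_set_scope.
Local Open Scope ring_scope.
Set Implicit Arguments.
Unset Strict Implicit.
Unset Printing Implicit Defensive.

(** Let [B_1, ..., B_d] be Bernoulli(1/2) and let [s_i] be the sign that is 1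
    where [B_i = 1] and -1 elsewhere. Almost surely [B_i = 1/2 + s_i / 2], so the
    correlation of [B_i] and [B_j] is [E[s_i s_j]]. On the product of the given
    space with the uniform law of [U] on [0, 1], put [X_i = U] where [s_i = 1] and
    [X_i = 1 - U] where [s_i = -1]. By Fubini and the invariance of the uniform law
    under [u |-> 1 - u], each [X_i] is uniform, hence has a continuous margin
    ([flip_law], [margin_flip]).

    Let [c] be the centre of symmetry of the law of [G], and write [Q] for the
    quantile function. Symmetry gives [Q(1 - u) - c = - (Q(u) - c)] for almost
    every [u], so [Q(X_i) - c = s_i (Q(U) - c)] almost surely. As [U] is
    independent of the signs, the covariance of [Q(X_i)] and [Q(X_j)] is
    [E[s_i s_j] v], where [v] is the variance of [G], which is finite and positive;
    since [s_i ^ 2 = 1], the correlation is [E[s_i s_j]] again.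

    The antisymmetry of [Q - c] ([quantile_reflect_ae]) comes from comparing means:
    [Q(u) + Q(1 - u) <= 2 c] holds for every [u] in the open unit interval
    ([quantile_reflect_le]), both sides have the same integral because [Q(U)] and
    [2 c - Q(U)] share the law of [G], hence the mean [c], and so the inequality is an equality almost
    everywhere. *)

(** * The uniform law on the unit interval *)

Section Uniform.
Variable R : realType.

(* Same Borel sets as on [R], carried by another instance; the identity
   transports the uniform law from one to the other. *)
Let idTR : measurableTypeR R -> R := idfun.
#[local] HB.instance Definition _ :=
  @isMeasurableFun.Build _ _ _ _ idTR (@measurable_id _ _ setT).

(** The uniform probability on [0, 1], as a probability on [R]. *)
Definition uniform01 : probability R R :=
  distribution (uniform_prob (@ltr01 R)) idTR.
Local Notation nu := uniform01.

(** The truncation of a real to [0, 1]; this is the distribution function of the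
    uniform law. *)
Definition clamp01 (x : R) : R := Num.max 0 (Num.min x 1).

(** Only the trace on [0, 1], here the segment from [l] to [r], counts. *)
Lemma uniform01_itv (a b : itv_bound R) (l r : R) :
  [set` Interval a b] `&` `[0, 1]%classic = [set` Interval (BLeft l) (BRight r)] ->
  0 <= l -> r <= 1 -> l <= r ->
  nu [set` Interval a b] = (r - l)%:E.
Proof.
move=> E l0 r1 lr.
rewrite /uniform01 /= /uniform_prob integral_uniform_pdf E.
rewrite (eq_integral (cst 1%:E)); last first.
  move=> x; rewrite inE/= in_itv/= => /andP[lx xr].
  by rewrite /uniform_pdf (le_trans l0 lx) (le_trans xr r1)/= subr0 invr1.
rewrite integral_cst//= mul1e lebesgue_measure_itv/= lte_fin.
case: ltP => // rl.
have -> : r = l by apply/eqP; rewrite eq_le lr rl.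
by rewrite subrr.
Qed.
Lemma uniform01_le (x : R) : nu `]-oo, x]%classic = (clamp01 x)%:E.
Proof.
have nu0 : nu `]-oo, 0]%classic = 0%E.
  rewrite (@uniform01_itv _ _ 0 0) ?subr0//.
  by apply/seteqP; split => y /=; rewrite !in_itv/=; lra.
rewrite /clamp01; have [x0|x0] := ltP x 0.
  rewrite min_l; last lra.
  rewrite max_l; last lra.
  apply/eqP; rewrite eq_le measure_ge0 andbT -[leRHS]nu0 le_measure ?inE//.
  by apply: subset_itvl; rewrite bnd_simp ltW.
have [x1|x1] := leP x 1.
  rewrite max_r// (@uniform01_itv _ _ 0 x) ?subr0//.
  by apply/seteqP; split => y /=; rewrite !in_itv/=; lra.
rewrite max_r// (@uniform01_itv _ _ 0 1) ?subr0//.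
by apply/seteqP; split => y /=; rewrite !in_itv/=; lra.
Qed.

(** The upper tail from [1 - x] has the same mass as the lower tail up to [x]:
    the uniform law is symmetric about 1/2. *)
Lemma uniform01_ge (x : R) : nu `[1 - x, +oo[%classic = (clamp01 x)%:E.
Proof.
have nu1 : nu `[1, +oo[%classic = 0%E.
  rewrite (@uniform01_itv _ _ 1 1) ?subrr//.
  by apply/seteqP; split => y /=; rewrite !in_itv/=; lra.
rewrite /clamp01; have [x0|x0] := ltP x 0.
  rewrite min_l; last lra.
  rewrite max_l; last lra.
  apply/eqP; rewrite eq_le measure_ge0 andbT -[leRHS]nu1 le_measure ?inE//.
  by apply: subset_itvr; rewrite bnd_simp; lra.
have [x1|x1] := leP x 1.
  rewrite max_r// (@uniform01_itv _ _ (1 - x) 1); [|  | lra..].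
    by congr EFin; lra.
  by apply/seteqP; split => y /=; rewrite !in_itv/=; lra.
rewrite max_r// (@uniform01_itv _ _ 0 1) ?subr0//.
by apply/seteqP; split => y /=; rewrite !in_itv/=; lra.
Qed.

Lemma clamp01_id (u : R) : 0 < u < 1 -> clamp01 u = u.
Proof.
by move=> /andP[u0 u1]; rewrite /clamp01 min_l 1?ltW// max_r// ltW.
Qed.

Lemma continuous_clamp01 : continuous clamp01.
Proof.
move=> x; apply: (@continuous_max R R (cst 0) (id \min cst 1)).
  exact: cvg_cst.
by apply: (@continuous_min R R id (cst 1)); [exact: cvg_id|exact: cvg_cst].
Qed.

Lemma uniform01_oo : nu `]0, 1[%classic = 1%E.
Proof.
have n0 : nu `]-oo, 0]%classic = 0%E.
  by rewrite uniform01_le /clamp01 min_l// maxxx.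
have n1 : nu `[1, +oo[%classic = 0%E.
  by have := uniform01_ge 0; rewrite subr0 /clamp01 min_l// maxxx.
have <- : nu (~` (`]-oo, 0] `|` `[1, +oo[))%classic = nu `]0, 1[%classic.
  congr (nu _); apply/seteqP; split => y /=; rewrite !in_itv/= ?andbT.
    by move=> /not_orP[/negP + /negP]; rewrite -!ltNge => -> ->.
  by move=> /andP[y0 y1] [|]; lra.
rewrite probability_setC; last exact: measurableU.
rewrite (_ : nu (_ `|` _) = 0)%E ?sube0//; apply/eqP.
by rewrite eq_le measure_ge0 andbT (le_trans (measureU2 _ _ _))//= n0 n1 adde0.
Qed.

Lemma uniform01_eq_on (A B : set R) : measurable A -> measurable B ->
  (forall u, 0 < u < 1 -> A u <-> B u) -> nu A = nu B.
Proof.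
have IE C : measurable C -> nu C = nu (C `&` `]0, 1[%classic).
  move=> mC; apply/eqP; rewrite eq_le andbC; apply/andP; split.
    exact: measureIl.
  rewrite -[leRHS]adde0 -[X in (_ + X)%E](_ : nu (~` `](0 : R), 1[%classic) = 0%E).
    have mCI := measurableI _ _ mC (measurable_itv `]0, 1[).
    have mI := measurableC (measurable_itv `](0:R), 1[).
    apply: le_trans (measureU2 nu mCI mI).
    rewrite le_measure ?inE//; first exact: measurableU.
    by move=> x Cx; have [?|?] := pselect (`]0, 1[%classic x); [left|right].
  by rewrite probability_setC// uniform01_oo subee.
move=> mA mB AB; rewrite IE// [RHS]IE//; congr (nu _).
by apply/seteqP; split => u /= [Au u01]; split => //; apply/AB => //;
  rewrite in_itv/= in u01.
Qed.

Lemma uniform01_ae (A : set R) : `]0, 1[%classic `<=` A ->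
  {ae nu, forall u, A u}.
Proof.
move=> A01; exists (~` `]0, 1[)%classic; split.
- exact: measurableC.
- by rewrite probability_setC// uniform01_oo subee.
- exact: subsetC.
Qed.

(** A probability on the line is determined by its distribution function. *)
Lemma probability_eq_cdf (P Q : probability R R) :
  (forall x, P `]-oo, x]%classic = Q `]-oo, x]%classic) ->
  forall A, measurable A -> P A = Q A.
Proof.
move=> PQ A mA.
have PQoy x : P `]x, +oo[%classic = Q `]x, +oo[%classic.
  by rewrite -setCitvl !probability_setC// PQ.
apply: (@measure_unique _ R R (@RGenOInfty.G R)
  (fun k : nat => `]- k%:R, +oo[%classic) _ _ _ _ P Q) => //.
- exact: RGenOInfty.measurableE.
- move=> _ _ [x ->] [y ->]; exists (Num.max x y).
  by apply/seteqP; split => z /=; rewrite !in_itv/= !andbT gt_max => /andP.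
- by move=> k; exists (- k%:R).
- apply/seteqP; split => // x _; exists (Num.trunc `|x|).+1 => //=.
  rewrite in_itv/= andbT ltrNl (le_lt_trans (ler_norm _))// normrN.
  by rewrite truncnS_gt.
- by move=> _ [x ->]; exact: PQoy.
- by move=> k; rewrite (le_lt_trans (probability_le1 _ _))// ltry.
Qed.

Lemma measurable_fun_reflect (a : R) : measurable_fun setT (fun u : R => a - u).
Proof. exact: measurable_funB. Qed.

Lemma uniform01_reflect (A : set R) : measurable A ->
  nu [set u | A (1 - u)] = nu A.
Proof.
pose X : R -> R := fun u => 1 - u.
have mX := measurable_fun_reflect 1 : measurable_fun setT X.
pose X' : {mfun R >-> R} := HB.pack X (isMeasurableFun.Build _ _ _ _ X mX).
move=> mA; rewrite -[RHS](@probability_eq_cdf (distribution nu X') nu)// => x.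
rewrite uniform01_le -uniform01_ge /distribution /pushforward/=; congr (nu _).
by apply/seteqP; split => y /=; rewrite /X !in_itv/= andbT; lra.
Qed.

End Uniform.

(** * Quantile functions *)

Section Quantile.
Variables (R : realType) (mu : probability R R) (G : R -> R).
Hypothesis muG : forall x : R, mu `]-oo, x]%classic = (G x)%:E.
Local Notation nu := (uniform01 R).
Local Notation Q := (quantile G).

Let idX : {mfun R >-> R} :=
  HB.pack (idfun : R -> R) (isMeasurableFun.Build _ _ _ _ (idfun : R -> R)
    (@measurable_id _ _ setT)).

Let cdfG : cdf (idX : {RV mu >-> R}) = EFin \o G.
Proof. by apply/funext => x; rewrite /= -muG. Qed.

Lemma dist_fun_ge0 x : 0 <= G x.
Proof. by rewrite -lee_fin -muG. Qed.

Lemma dist_fun_le1 x : G x <= 1.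
Proof. by rewrite -lee_fin -muG probability_le1. Qed.

Lemma dist_fun_nondecreasing : {homo G : x y / x <= y}.
Proof.
move=> x y xy; rewrite -lee_fin -!muG le_measure ?inE//.
exact: subset_itvl.
Qed.

Lemma dist_fun_exists_lt p : 0 < p -> exists x, G x < p.
Proof.
move=> p0; have := cvg_cdfNy0 (idX : {RV mu >-> R}); rewrite cdfG.
move/fine_cvg => /cvgr_lt /(_ p p0) [M [_ HM]].
by exists (M - 1); apply: (HM (M - 1)); lra.
Qed.

Lemma dist_fun_exists_ge p : p < 1 -> exists x, p <= G x.
Proof.
move=> p1; have := cvg_cdfy1 (idX : {RV mu >-> R}); rewrite cdfG.
move/fine_cvg => /cvgr_gt /(_ p p1) [M [_ HM]].
by exists (M + 1); apply: ltW; apply: (HM (M + 1)); lra.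
Qed.

(** Right continuity, in the form of preservation of lower bounds. *)
Lemma dist_fun_right_continuous x p :
  (forall y, x < y -> p <= G y) -> p <= G x.
Proof.
move=> xp; rewrite leNgt; apply/negP => Gxp.
have := @cdf_right_continuous _ _ _ mu (idX : {RV mu >-> R}) x.
rewrite cdfG => /fine_cvg/cvgr_lt/(_ p Gxp) H.
have : \forall y \near x^'+, x < y by exact: nbhs_right_gt.
move=> H'; have [y [/xp + yp]] := filter_ex (filterI H' H).
by rewrite leNgt yp.
Qed.

(** The Galois connection between a distribution function and its quantile
    function. *)
Lemma quantile_le u x : 0 < u < 1 -> (Q u <= x) = (u <= G x).
Proof.
move=> /andP[u0 u1]; have [y Gyu] := dist_fun_exists_lt u0.
have lbQ : has_lbound [set x | u <= G x].
  exists y => z /= uz; rewrite leNgt; apply/negP => zy.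
  by have := dist_fun_nondecreasing (ltW zy); lra.
apply/idP/idP => [Qx|]; last exact: ge_inf.
apply: dist_fun_right_continuous => z xz.
have [w uw wz] : exists2 w, u <= G w & w < z.
  apply: inf_lt; last exact: le_lt_trans xz.
  by have [w] := dist_fun_exists_ge u1; exists w.
by rewrite (le_trans uw)// dist_fun_nondecreasing// ltW.
Qed.

(** The quantile function precomposed with the truncation to [0, 1], a function
    on the whole line. Its values at [u <= 0] and [u >= 1] may be default
    values of [inf] and are immaterial: they are taken with probability zero
    under [uniform01]. *)
Definition quantile01 (u : R) : R := quantile G (clamp01 u).

Lemma measurable_quantile01 : measurable_fun [set: R] quantile01.
Proof.
have -> : quantile01 =
    fun u => if u <= 0 then Q 0 else if 1 <= u then Q 1 else Q u.
  apply/funext => u; rewrite /quantile01 /clamp01.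
  case: ifPn => [u0|]; first by rewrite min_l ?max_l//; lra.
  rewrite -ltNge => u0; case: ifPn => [u1|]; first by rewrite min_r// max_r.
  by rewrite -ltNge => u1; rewrite min_l ?max_r//; lra.
apply: measurable_fun_if => //; first exact: measurable_fun_ler.
have -> : [set: R] `&` (fun u : R => u <= 0) @^-1` [set false] = `]0, +oo[%classic.
  apply/seteqP; split => u /=; rewrite in_itv/= andbT ltNge; first by move=> [_ ->].
  by move=> /negbTE.
apply: measurable_fun_if => //; first exact: measurable_fun_ler.
have -> : `]0, +oo[ `&` (fun u : R => 1 <= u) @^-1` [set false] = `]0, 1[%classic.
  apply/seteqP; split => u /=; rewrite !in_itv/= andbT [u < 1]ltNge.
    by move=> [-> ->].
  by move=> /andP[-> /negbTE].
(* On the open unit interval, [r < Q u] means [G r < u]. *)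
apply: (measurability (@RGenOInfty.G R)) => [|/= _ [_] [r] -> <-].
  exact: RGenOInfty.measurableE.
rewrite (_ : _ `&` _ = `]0, 1[ `&` `]G r, +oo[%classic); first exact: measurableI.
apply/seteqP; split => u /= []; rewrite /preimage/= !in_itv/= !andbT => u01;
  by rewrite [_ < quantile _ _]ltNge quantile_le// -ltNge.
Qed.

Lemma quantile01_id u : 0 < u < 1 -> quantile01 u = quantile G u.
Proof. by move=> u01; rewrite /quantile01 clamp01_id. Qed.

Let qX : {mfun R >-> R} :=
  HB.pack quantile01 (isMeasurableFun.Build _ _ _ _ quantile01
    measurable_quantile01).

(** The quantile transform of a uniform variable has distribution function [G]. *)
Lemma quantile01_law (A : set R) : measurable A ->
  pushforward nu quantile01 A = mu A.
Proof.
move=> mA; rewrite -[RHS](@probability_eq_cdf _ (distribution nu qX) mu)// => x.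
rewrite muG /distribution /pushforward/=.
transitivity (nu `]-oo, G x]%classic); last first.
  rewrite uniform01_le /clamp01 min_l ?dist_fun_le1// max_r//.
  exact: dist_fun_ge0.
have mq : measurable (quantile01 @^-1` `]-oo, x]).
  by rewrite -[X in measurable X]setTI; exact: measurable_quantile01.
apply: uniform01_eq_on => // u u01.
by rewrite /preimage/= !in_itv/= quantile01_id// quantile_le.
Qed.

End Quantile.

(** * Change of variables *)

(** Integration against the law [P'] of the map [phi] under [P]. *)
Section Law.
Context d d' (T : measurableType d) (T' : measurableType d') (R : realType).
Variables (P : probability T R) (P' : probability T' R) (phi : T -> T').
Hypothesis mphi : measurable_fun [set: T] phi.
Hypothesis law : forall A, measurable A -> P (phi @^-1` A) = P' A.

Let integral_law' (f : T' -> \bar R) :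
  (\int[P']_x f x = \int[pushforward P phi]_x f x)%E.
Proof.
pose X : {mfun T >-> T'} := HB.pack phi (isMeasurableFun.Build _ _ _ _ phi mphi).
rewrite -[pushforward P phi]/(distribution P X : set T' -> \bar R).
by apply: eq_measure_integral => A mA _; exact/esym/law.
Qed.

Lemma ge0_integral_law (f : T' -> \bar R) : measurable_fun [set: T'] f ->
  (forall x, 0 <= f x)%E -> (\int[P]_u f (phi u) = \int[P']_x f x)%E.
Proof. by move=> mf f0; rewrite integral_law' (ge0_integral_pushforward mphi). Qed.

Lemma integral_law (f : T' -> \bar R) : measurable_fun [set: T'] f ->
  P.-integrable [set: T] (f \o phi) ->
  (\int[P]_u f (phi u) = \int[P']_x f x)%E.
Proof. by move=> mf intf; rewrite integral_law' (integral_pushforward mphi). Qed.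

End Law.

(** * Quantiles of a symmetric law *)

Section Symmetric.
Variables (R : realType) (mu : probability R R) (G : R -> R).
Hypothesis muG : forall x : R, mu `]-oo, x]%classic = (G x)%:E.
Hypothesis mu_nondeg : forall a : R, mu [set a] <> 1%E.
Variable c : R.
Hypothesis mu_sym : forall A : set R, measurable A ->
  mu [set x | A (c *+ 2 - x)] = mu A.
Hypothesis mu_L2 : (\int[mu]_x (x ^+ 2)%:E < +oo)%E.
Local Notation nu := (uniform01 R).
Local Notation q := (quantile01 G).

Let mq : measurable_fun [set: R] q := measurable_quantile01 muG.

(** For [y < Q u] one has [G y < u], so the mass of the ray above [y] exceeds
    [1 - u]; by symmetry this mass is at most [G (2 c - y)], whence
    [Q (1 - u) <= 2 c - y]. Letting [y] tend to [Q u] gives the claim. *)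
Lemma quantile_reflect_le u : 0 < u < 1 ->
  quantile G (1 - u) <= c *+ 2 - quantile G u.
Proof.
move=> u01; have v01 : 0 < 1 - u < 1 by lra.
apply/ler_addgt0Pr => e e0.
set y := quantile G u - e.
rewrite (_ : _ + e = c *+ 2 - y); last by rewrite /y; lra.
have Gyu : G y < u by rewrite ltNge -(quantile_le muG)// /y; lra.
rewrite (quantile_le muG)// -lee_fin -muG.
apply: (@le_trans _ _ (mu `]y, +oo[%classic)).
  by rewrite -setCitvl probability_setC// muG -EFinB lee_fin; lra.
rewrite -(@mu_sym `]-oo, c *+ 2 - y]%classic)//.
have -> : [set x | `]-oo, c *+ 2 - y]%classic (c *+ 2 - x)] = `[y, +oo[%classic.
  by apply/seteqP; split => x /=; rewrite !in_itv/= andbT; lra.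
rewrite le_measure ?inE//.
by move=> x /=; rewrite !in_itv/= !andbT => /ltW.
Qed.

Lemma integrable_quantile_sqr : nu.-integrable [set: R] (fun u => (q u ^+ 2)%:E).
Proof.
apply/integrableP; split.
  by apply/measurable_EFinP; exact: measurable_funX.
under eq_integral => u _ do rewrite gee0_abs ?lee_fin ?sqr_ge0//.
rewrite (ge0_integral_law mq (quantile01_law muG) (f := fun x => (x ^+ 2)%:E))//.
  by apply/measurable_EFinP; exact: measurable_funX.
by move=> x; rewrite lee_fin sqr_ge0.
Qed.

Lemma integrable_cst01 (r : R) : nu.-integrable [set: R] (fun=> r%:E).
Proof. exact: finite_measure_integrable_cst. Qed.

Lemma integrable_quantile : nu.-integrable [set: R] (fun u => (q u)%:E).
Proof.
apply: (@le_integrable _ _ _ nu _ _ _ (fun u => (1 + q u ^+ 2)%:E)) => //.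
- exact/measurable_EFinP.
- move=> u _; rewrite !abse_EFin lee_fin [leRHS]ger0_norm ?addr_ge0 ?sqr_ge0//.
  by rewrite ler_norml; nra.
- apply: (eq_integrable _ (fun u => 1 + (q u ^+ 2)%:E)%E) => //.
  apply: integrableD => //; [exact: integrable_cst01|exact: integrable_quantile_sqr].
Qed.

(** Both [Q(U)] and [2 c - Q(U)] have law [mu], so their means agree. *)
Lemma mean_quantile : (\int[nu]_u (q u)%:E = c%:E)%E.
Proof.
have mr : measurable_fun [set: R] (fun u => c *+ 2 - q u) by exact: measurable_funB.
have rlaw A : measurable A -> nu ((fun u => c *+ 2 - q u) @^-1` A) = mu A.
  move=> mA; rewrite -mu_sym// -(quantile01_law muG)//.
  by rewrite -[X in measurable X]setTI; exact: (measurable_fun_reflect (c *+ 2)).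
have iq := integrable_quantile.
have ir : nu.-integrable [set: R] (fun u => (c *+ 2 - q u)%:E).
  by apply: (integrableB _ (integrable_cst01 _) iq).
have refl : (\int[nu]_u (c *+ 2 - q u)%:E = (c *+ 2)%:E - \int[nu]_u (q u)%:E)%E.
  under eq_integral do rewrite EFinB.
  rewrite (integralB_EFin measurableT (integrable_cst01 _) iq).
  by rewrite integral_cst//= probability_setT mule1.
have := integral_law mr rlaw (@EFin_measurable R setT) ir.
rewrite -(integral_law mq (quantile01_law muG) (@EFin_measurable R setT) iq)/= refl.
have /fineK <- := integrable_fin_num measurableT iq.
by rewrite -EFinB => -[?]; congr EFin; lra.
Qed.

(** The function [2 c - q u - q (1 - u)] is almost surely nonnegative and has
    integral zero. *)
Lemma quantile_reflect_ae : {ae nu, forall u, q (1 - u) - c = - (q u - c)}.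
Proof.
have mr : measurable_fun [set: R] (fun u => 1 - u) := measurable_fun_reflect 1.
have iq := integrable_quantile.
have mqr : measurable_fun [set: R] (fun u => q (1 - u)) by exact: measurableT_comp.
have iqr : nu.-integrable [set: R] (fun u => (q (1 - u))%:E).
  apply/integrableP; split; first exact/measurable_EFinP.
  rewrite (ge0_integral_law mr (@uniform01_reflect R) (f := fun v => `|(q v)%:E|%E))//.
    by have /integrableP[] := iq.
  by apply: measurableT_comp => //; exact/measurable_EFinP.
have mk : measurable_fun [set: R] (fun u => c *+ 2 - q u - q (1 - u)).
  by apply: measurable_funB => //; exact: measurable_funB.
have k0 : (\int[nu]_u (c *+ 2 - q u - q (1 - u))%:E = 0)%E.
  under eq_integral do rewrite EFinB.
  rewrite integralB_EFin//; last first.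
    by apply: (integrableB _ (integrable_cst01 _) iq).
  rewrite (integral_law mr (@uniform01_reflect R) (f := fun v => (q v)%:E))//; last first.
    exact/measurable_EFinP.
  under eq_integral do rewrite EFinB.
  rewrite (integralB_EFin measurableT (integrable_cst01 _) iq).
  rewrite integral_cst//= probability_setT mule1 mean_quantile -!EFinB.
  by congr EFin; lra.
have kge0 : {ae nu, forall u, 0 <= c *+ 2 - q u - q (1 - u)}.
  apply: uniform01_ae => u /=; rewrite in_itv/= => u01.
  have v01 : 0 < 1 - u < 1 by lra.
  by rewrite !quantile01_id//; have := quantile_reflect_le u01; lra.
have : (\int[nu]_u `|(c *+ 2 - q u - q (1 - u))%:E| = 0)%E.
  rewrite -[RHS]k0; apply: ae_eq_integral => //.
  - by apply: measurableT_comp => //; exact/measurable_EFinP.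
  - exact/measurable_EFinP.
  - by apply: filterS kge0 => u u0 _; rewrite gee0_abs.
move/ae_eq_integral_abs => /(_ measurableT).
have /measurable_EFinP mk' := mk.
by move=> /(_ mk') H; apply: filterS H => u /(_ I) [?]; lra.
Qed.

Lemma integrable_quantile_centered : nu.-integrable [set: R] (fun u => (q u - c)%:E).
Proof. exact: (integrableB _ integrable_quantile (integrable_cst01 c)). Qed.

Lemma mean_quantile_centered : (\int[nu]_u (q u - c)%:E = 0)%E.
Proof.
under eq_integral do rewrite EFinB.
rewrite (integralB_EFin measurableT integrable_quantile (integrable_cst01 c)).
by rewrite mean_quantile integral_cst//= probability_setT mule1 subee.
Qed.

Lemma integrable_quantile_centered_sqr :
  nu.-integrable [set: R] (fun u => ((q u - c) ^+ 2)%:E).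
Proof.
apply: (@le_integrable _ _ _ nu _ _ _
  (fun u => (2 * c ^+ 2)%:E + 2%:E * (q u ^+ 2)%:E)%E) => //.
- by apply/measurable_EFinP/measurable_funX; exact: measurable_funB.
- move=> u _; rewrite -EFinM -EFinD !abse_EFin lee_fin !ger0_norm ?sqr_ge0//; last first.
    by rewrite addr_ge0// mulr_ge0// sqr_ge0.
  by have := sqr_ge0 (q u + c); lra.
- apply: integrableD => //; first exact: integrable_cst01.
  by apply: integrableZl => //; exact: integrable_quantile_sqr.
Qed.

Lemma variance_quantile_gt0 : exists2 v : R, 0 < v &
  (\int[nu]_u ((q u - c) ^+ 2)%:E = v%:E)%E.
Proof.
have /fineK E := integrable_fin_num measurableT integrable_quantile_centered_sqr.
exists (fine (\int[nu]_u ((q u - c) ^+ 2)%:E)); last by rewrite E.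
rewrite lt_neqAle fine_ge0 ?andbT; last first.
  by apply: integral_ge0 => u _; rewrite lee_fin sqr_ge0.
apply/eqP => v0.
have : (\int[nu]_u `|((q u - c) ^+ 2)%:E| = 0)%E.
  by under eq_integral do rewrite gee0_abs ?lee_fin ?sqr_ge0//; rewrite -E -v0.
have mf : measurable_fun [set: R] (fun u => ((q u - c) ^+ 2)%:E).
  by apply/measurable_EFinP/measurable_funX; exact: measurable_funB.
move/(ae_eq_integral_abs nu measurableT mf) => qc.
apply: (mu_nondeg (a := c)).
rewrite -(quantile01_law muG)//.
have mqc : measurable (q @^-1` [set c]).
  by rewrite -[X in measurable X]setTI; exact: mq.
have qc0 : nu (~` (q @^-1` [set c])) = 0%E.
  apply: measure_negligible; first exact: measurableC.
  have : {ae nu, forall u, q u = c}; last by [].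
  by apply: filterS qc => u /(_ I) [] /eqP; rewrite sqrf_eq0 subr_eq0 => /eqP.
have := probability_setC nu mqc; rewrite qc0 /pushforward.
rewrite -[nu (q @^-1` _)]fineK ?fin_num_measure// -EFinB => -[?].
by congr EFin; lra.
Qed.

End Symmetric.

(** * Covariance of almost surely centred decompositions *)

Section Centered.
Context d (T : measurableType d) (R : realType) (P : probability T R).

Lemma expectation_ae_centered (X V : T -> R) (a : R) :
  measurable_fun [set: T] X -> P.-integrable [set: T] (EFin \o V) ->
  {ae P, forall t, X t = a + V t} -> (\int[P]_t (V t)%:E = 0)%E ->
  ('E_P[X] = a%:E)%E.
Proof.
move=> mX iV XV V0.
have mV := measurable_int P iV.
rewrite unlock (ae_eq_integral (fun t => (a + V t)%:E))//.
- under eq_integral do rewrite EFinD.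
  rewrite integralD//; last exact: finite_measure_integrable_cst.
  by rewrite V0 adde0 integral_cst//= probability_setT mule1.
- exact/measurable_EFinP.
- by apply/measurable_EFinP/measurable_funD => //; exact/measurable_EFinP.
- by apply: filterS XV => t -> _.
Qed.

Lemma covariance_ae_centered (X Y V W : T -> R) (a b : R) :
  measurable_fun [set: T] X -> measurable_fun [set: T] Y ->
  P.-integrable [set: T] (EFin \o V) -> P.-integrable [set: T] (EFin \o W) ->
  {ae P, forall t, X t = a + V t} -> {ae P, forall t, Y t = b + W t} ->
  (\int[P]_t (V t)%:E = 0)%E -> (\int[P]_t (W t)%:E = 0)%E ->
  covariance P X Y = (\int[P]_t (V t * W t)%:E)%E.
Proof.
move=> mX mY iV iW XV YW V0 W0.
rewrite unlock (expectation_ae_centered mX iV XV V0).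
rewrite (expectation_ae_centered mY iW YW W0) unlock.
have /measurable_EFinP mV := measurable_int P iV.
have /measurable_EFinP mW := measurable_int P iW.
apply: ae_eq_integral => //.
- by apply/measurable_EFinP/measurable_funM; exact: measurable_funB.
- by apply/measurable_EFinP; exact: measurable_funM.
- apply: filterS2 XV YW => t /= Xt Yt _; congr EFin.
  by change ((X t - a) * (Y t - b) = V t * W t); rewrite Xt Yt; ring.
Qed.

End Centered.

(** * Products with an independent factor *)

Section Product.
Context d d' (T : measurableType d) (T' : measurableType d') (R : realType).
Variables (P : probability T R) (P' : probability T' R).
Local Notation PP := (P \x P')%E.

Lemma product_ae (Q : T' -> Prop) : {ae P', forall y, Q y} ->
  {ae PP, forall z, Q z.2}.
Proof.
move=> [N [mN N0 QN]]; exists ([set: T] `*` N); split.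
- exact: measurableX.
- transitivity (P [set: T] * P' N)%E; first exact: product_measure1E.
  by rewrite N0 mule0.
- by move=> z /= Qz; split => //; exact: QN.
Qed.

Variables (a : T -> R) (b : T' -> R).
Hypothesis (ma : measurable_fun [set: T] a) (a1 : forall t, `|a t| <= 1).
Hypothesis (ib : P'.-integrable [set: T'] (EFin \o b)).

Let mb : measurable_fun [set: T'] b.
Proof. exact/measurable_EFinP/(measurable_int P' ib). Qed.

Lemma integrable_product : PP.-integrable [set: T * T'] (fun z => (a z.1 * b z.2)%:E).
Proof.
have mb2 : measurable_fun [set: T * T'] (fun z => b z.2) by exact: measurableT_comp.
have ma2 : measurable_fun [set: T * T'] (fun z => a z.1) by exact: measurableT_comp.
apply: (@le_integrable _ _ _ PP _ _ _ (fun z => (b z.2)%:E)) => //.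
- by apply/measurable_EFinP; exact: measurable_funM.
- by move=> z _; rewrite !abse_EFin lee_fin normrM ler_piMl.
- apply/(integrable12ltyP P P'); first exact/measurable_EFinP.
  rewrite -[ltLHS]/(\int[P]_x cst (\int[P']_y `|(b y)%:E|) x)%E.
  rewrite integral_cst// [X in (_ * X)%E](probability_setT P) mule1.
  by have /integrableP[] := ib.
Qed.

(** Factors depending on different coordinates are independent, so the expectation
    of their product is the product of their expectations. *)
Lemma integral_product : P.-integrable [set: T] (EFin \o a) ->
  (\int[PP]_z (a z.1 * b z.2)%:E =
  \int[P]_t (a t)%:E * \int[P']_y (b y)%:E)%E.
Proof.
move=> ia; rewrite -(integral12_prod_meas1 integrable_product) /fubini_F/=.
under eq_integral.
  move=> x _; under eq_integral do rewrite EFinM.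
  rewrite (integralZl measurableT ib); over.
rewrite /= -(fineK (integrable_fin_num measurableT ib)).
by rewrite (integralZr measurableT ia).
Qed.

End Product.

(** * Random signs and reflected uniform variables *)

Section Flip.
Context d (T : measurableType d) (R : realType) (P : probability T R).
Local Notation nu := (uniform01 R).
Local Notation PP := (P \x nu)%E.

(** The sign 1 or -1 encoded by a boolean. *)
Definition sign_of (s : T -> bool) (t : T) : R := if s t then 1 else -1.

(** The second coordinate, reflected to [1 - u] where [s] is false. *)
Definition flip (s : T -> bool) (z : T * R) : R := if s z.1 then z.2 else 1 - z.2.

Variable s : T -> bool.
Hypothesis ms : measurable_fun [set: T] s.

Lemma measurable_sign_of : measurable_fun [set: T] (sign_of s).
Proof. by apply: measurable_fun_if. Qed.

Lemma norm_sign_of t : `|sign_of s t| = 1.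
Proof. by rewrite /sign_of; case: ifP => _; rewrite ?normrN1 ?normr1. Qed.

Lemma integrable_sign_of : P.-integrable [set: T] (EFin \o sign_of s).
Proof.
apply: (@le_integrable _ _ _ P _ _ _ (EFin \o cst 1)) => //.
- by apply/measurable_EFinP; exact: measurable_sign_of.
- by move=> t _ /=; rewrite norm_sign_of normr1.
- exact: finite_measure_integrable_cst.
Qed.

Lemma measurable_flip : measurable_fun [set: T * R] (flip s).
Proof.
apply: measurable_fun_if => //.
- exact: measurableT_comp.
- by apply: measurable_funTS; exact: measurable_snd.
- by apply: measurable_funTS; apply: measurable_funB => //; exact: measurable_snd.
Qed.

(** Every section of the preimage has the uniform measure of [A], whatever the
    value of the sign. *)
Lemma flip_law (A : set R) : measurable A -> PP (flip s @^-1` A) = nu A.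
Proof.
move=> mA; rewrite /product_measure1.
rewrite (eq_integral (cst (nu A))).
  by rewrite integral_cst//= probability_setT mule1.
move=> t _ /=; rewrite /xsection/=.
rewrite /flip; case: (boolP (s t)) => st.
  by congr (nu _); apply/seteqP; split=> u /=; rewrite inE/= st.
rewrite -[RHS]uniform01_reflect//.
by congr (nu _); apply/seteqP; split=> u /=; rewrite inE/= (negbTE st).
Qed.

End Flip.

(** The event [X = 1], as a boolean function. *)
Definition is_one (T : Type) (R : realType) (X : T -> R) (t : T) : bool := X t == 1.

Lemma measurable_is_one d (T : measurableType d) (R : realType) (X : T -> R) :
  measurable_fun [set: T] X -> measurable_fun [set: T] (is_one X).
Proof. by move=> mX; exact: measurable_fun_eqr. Qed.

Section Bernoulli.
Context d (T : measurableType d) (R : realType) (P : probability T R).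
Variable B : {RV P >-> R}.
Hypothesis lawB : has_bernoulli_law 2^-1 B.
Local Notation sgn := (@sign_of _ T R (is_one B)).

Let half01 : 0 <= (2^-1 : R) <= 1.
Proof. by lra. Qed.

Lemma bernoulli_half_one : P [set t | is_one B t] = (2^-1)%:E.
Proof.
have := lawB (measurable_set1 (1 : R)).
rewrite bernoulli_probE// /distribution /pushforward.
rewrite !diracE mem_set//= memNset/=; last by move/eqP; rewrite eq_sym oner_eq0.
rewrite mule1 mule0 adde0 => <-; congr (P _).
by apply/seteqP; split => t /= /eqP.
Qed.

Lemma bernoulli_half_ae : {ae P, forall t, B t = 2^-1 + 2^-1 * sgn t}.
Proof.
have m01 : measurable ([set 0] `|` [set 1] : set R) by exact: measurableU.
have := lawB m01.
rewrite bernoulli_probE// /distribution /pushforward.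
rewrite !diracE !mem_set/=; [|by left|by right].
rewrite !mule1 -EFinD => P1.
have mB : measurable (B @^-1` ([set 0] `|` [set 1])).
  by rewrite -[X in measurable X]setTI; exact: measurable_funP.
exists (~` (B @^-1` ([set 0] `|` [set 1]))); split.
- exact: measurableC.
- by rewrite probability_setC// P1 -EFinB; congr EFin; rewrite /unstable.onem; lra.
- apply: subsetC => t /=; rewrite /sign_of /is_one => -[] ->.
    by rewrite eq_sym oner_eq0; lra.
  by rewrite eqxx; lra.
Qed.

Lemma integral_sign_bernoulli : (\int[P]_t (sgn t)%:E = 0)%E.
Proof.
have mA : measurable [set t | is_one B t].
  rewrite -[X in measurable X]setTI.
  by apply: (measurable_is_one (measurable_funPT B) measurableT (Y := [set true])).
rewrite (eq_integral (fun t => (2 * \1_[set t | is_one B t] t)%:E - 1%:E)%E); last first.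
  move=> t _; rewrite /sign_of indicE -EFinB; congr EFin.
  case: ifPn => [tA|/negP tA].
    by rewrite mem_set// mulr1n; lra.
  by rewrite memNset// mulr0n; lra.
have i1 : P.-integrable [set: T] (EFin \o (fun t => 2 * \1_[set t | is_one B t] t)).
  apply: (eq_integrable _ (fun t => 2%:E * (\1_[set t | is_one B t] t)%:E)%E) => //.
  by apply: integrableZl => //; apply: integrable_indic.
rewrite integralB_EFin//; last exact: finite_measure_integrable_cst.
under eq_integral do rewrite EFinM.
rewrite integralZl//; last exact: integrable_indic.
rewrite integral_indic// setIT [X in (_ * X - _)%E]bernoulli_half_one integral_cst//.
rewrite [X in (_ - _ * X)%E]probability_setT.
by rewrite mule1 -EFinM -EFinB; congr EFin; lra.
Qed.

End Bernoulli.

(** * Correlations as expectations of products of signs *)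

Section Correlation.
Context d (T : measurableType d) (R : realType) (P : probability T R).

Lemma correlation_scaled (X Y : T -> R) (e v : R) : 0 < v ->
  covariance P X Y = (e * v)%:E -> covariance P X X = v%:E ->
  covariance P Y Y = v%:E -> correlation P X Y = e.
Proof.
move=> v0 XY XX YY; rewrite /correlation /variance XY XX YY/=.
by rewrite -expr2 sqr_sqrtr ?mulfK ?gt_eqF// ltW.
Qed.

Section Signs.
Variables s s' : T -> bool.
Hypotheses (ms : measurable_fun [set: T] s) (ms' : measurable_fun [set: T] s').
Local Notation sg := (@sign_of _ T R).

(** The expectation of the product of the two signs. *)
Definition sign_corr : R := fine (\int[P]_t (sg s t * sg s' t)%:E).

Lemma integrable_sign_mul : P.-integrable [set: T] (EFin \o (fun t => sg s t * sg s' t)).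
Proof.
apply: (@le_integrable _ _ _ P _ _ _ (EFin \o cst 1)) => //.
- by apply/measurable_EFinP/measurable_funM; exact: measurable_sign_of.
- by move=> t _ /=; rewrite normrM !norm_sign_of mulr1 normr1.
- exact: finite_measure_integrable_cst.
Qed.

Lemma sign_corrE : (\int[P]_t (sg s t * sg s' t)%:E)%E = sign_corr%:E.
Proof. by rewrite fineK// integrable_fin_num// integrable_sign_mul. Qed.

Lemma norm_sign_corr : `|sign_corr| <= 1.
Proof.
rewrite -lee_fin -abse_EFin -sign_corrE.
have /measurable_EFinP := measurable_int P integrable_sign_mul.
move=> /measurable_EFinP m; apply: le_trans (le_abse_integral P measurableT m) _.
rewrite (eq_integral (cst 1%E)); last first.
  by move=> t _; rewrite /= normrM !norm_sign_of mulr1.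
by rewrite integral_cst// mul1e [leLHS]probability_setT.
Qed.

End Signs.

Lemma sign_corr_diag s : measurable_fun [set: T] s -> sign_corr s s = 1.
Proof.
move=> ms; rewrite /sign_corr (eq_integral (cst 1%E)).
  by rewrite integral_cst// mul1e [X in fine X]probability_setT.
by move=> t _; rewrite /sign_of; case: ifP => _ /=; congr EFin; lra.
Qed.

End Correlation.

(** The covariance is a quarter of [sign_corr], because [X - 1/2] and [Y - 1/2]
    are almost surely halves of signs. *)
Lemma correlation_bernoulli_half d (T : measurableType d) (R : realType)
    (P : probability T R) (X Y : {RV P >-> R}) :
  has_bernoulli_law 2^-1 X -> has_bernoulli_law 2^-1 Y ->
  correlation P X Y = sign_corr P (is_one X) (is_one Y).
Proof.
have mO (W : {RV P >-> R}) : measurable_fun [set: T] (is_one W).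
  exact/measurable_is_one/measurable_funPT.
have cov (U V : {RV P >-> R}) : has_bernoulli_law 2^-1 U -> has_bernoulli_law 2^-1 V ->
    covariance P U V = (sign_corr P (is_one U) (is_one V) * 4^-1)%:E.
  move=> lU lV.
  have iS (W : {RV P >-> R}) : P.-integrable [set: T]
      (fun t => 2^-1%:E * (sign_of R (is_one W) t)%:E)%E.
    by apply: integrableZl => //; apply: integrable_sign_of; exact: mO.
  have S0 (W : {RV P >-> R}) : has_bernoulli_law 2^-1 W ->
      (\int[P]_t (2^-1 * sign_of R (is_one W) t)%:E = 0)%E.
    move=> lW; under eq_integral do rewrite EFinM.
    rewrite integralZl ?integral_sign_bernoulli ?mule0//.
    by apply: integrable_sign_of; exact: mO.
  rewrite (covariance_ae_centered _ _ (iS U) (iS V) (bernoulli_half_ae lU)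
    (bernoulli_half_ae lV) (S0 _ lU) (S0 _ lV))//.
  rewrite (eq_integral (fun t => 4^-1%:E *
      (sign_of R (is_one U) t * sign_of R (is_one V) t)%:E)%E); last first.
    by move=> t _; rewrite -EFinM; congr EFin; lra.
  rewrite integralZl//; last by apply: integrable_sign_mul; exact: mO.
  by rewrite (sign_corrE P (mO U) (mO V)) -EFinM mulrC.
move=> lX lY; apply: (@correlation_scaled _ _ _ _ _ _ _ 4^-1); [by []|exact: cov|..].
- by rewrite cov// sign_corr_diag ?mul1r//; exact: mO.
- by rewrite cov// sign_corr_diag ?mul1r//; exact: mO.
Qed.

(** * The coupling of uniform margins *)

Section Coupling.
Context d (T : measurableType d) (R : realType) (P : probability T R).
Local Notation nu := (uniform01 R).
Local Notation PP := (P \x nu)%E.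

Lemma margin_flip (s : T -> bool) (X : {RV PP >-> R}) :
  (X : T * R -> R) = flip s ->
  margin X = @clamp01 R.
Proof.
move=> XE; apply/funext => x.
rewrite /margin /cdf /distribution /pushforward XE.
by rewrite [X in fine X](flip_law P s (measurable_itv _)) uniform01_le.
Qed.

(** The law of [G] enters only through its variance [v], which cancels. *)
Lemma correlation_flip (G : R -> R) (s s' : T -> bool) :
  concordance_inducing G ->
  measurable_fun [set: T] s -> measurable_fun [set: T] s' ->
  correlation PP (quantile01 G \o flip s) (quantile01 G \o flip s') =
  sign_corr P s s'.
Proof.
move=> [mu [muG mu_nd [c mu_sym] mu_L2]].
have [v v0 vE] := variance_quantile_gt0 muG mu_nd c mu_L2.
(* [W s0] is the centred part of the quantile transform of [flip s0]. *)
pose W (s0 : T -> bool) (z : T * R) := sign_of R s0 z.1 * (quantile01 G z.2 - c).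
have WE s0 : {ae PP, forall z, (quantile01 G \o flip s0) z = c + W s0 z}.
  have := product_ae P (quantile_reflect_ae muG mu_sym mu_L2).
  apply: filterS => -[t u] /= H; rewrite /W /flip /sign_of/=.
  by case: ifP => _; lra.
have s1 s0 (t : T) : `|sign_of R s0 t| <= 1 by rewrite norm_sign_of.
have ic := integrable_quantile_centered muG c mu_L2.
have iW (s0 : T -> bool) : measurable_fun [set: T] s0 ->
    PP.-integrable [set: T * R] (EFin \o W s0).
  by move=> ms0; exact: (integrable_product P (measurable_sign_of ms0) (s1 s0) ic).
have W0 (s0 : T -> bool) : measurable_fun [set: T] s0 -> (\int[PP]_z (W s0 z)%:E = 0)%E.
  move=> ms0.
  rewrite (integral_product (measurable_sign_of ms0) (s1 s0) ic
    (integrable_sign_of P ms0)).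
  by rewrite (mean_quantile_centered muG mu_sym mu_L2) mule0.
have mY (s0 : T -> bool) : measurable_fun [set: T] s0 ->
    measurable_fun [set: T * R] (quantile01 G \o flip s0).
  move=> ms0; apply: measurableT_comp; first exact: (measurable_quantile01 muG).
  exact: measurable_flip.
have cov (s2 s3 : T -> bool) : measurable_fun [set: T] s2 -> measurable_fun [set: T] s3 ->
    covariance PP (quantile01 G \o flip s2) (quantile01 G \o flip s3) =
    (sign_corr P s2 s3 * v)%:E.
  move=> m2 m3.
  rewrite (covariance_ae_centered (mY _ m2) (mY _ m3) (iW _ m2) (iW _ m3)
    (WE s2) (WE s3) (W0 _ m2) (W0 _ m3)).
  rewrite (eq_integral (fun z => (sign_of R s2 z.1 * sign_of R s3 z.1 *
    (quantile01 G z.2 - c) ^+ 2)%:E)); last first.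
    by move=> z _; congr EFin; rewrite /W; lra.
  rewrite (integral_product (a := fun t => sign_of R s2 t * sign_of R s3 t)
    (b := fun u => (quantile01 G u - c) ^+ 2)).
  - by rewrite vE sign_corrE.
  - by apply: measurable_funM; exact: measurable_sign_of.
  - by move=> t; rewrite normrM !norm_sign_of mulr1.
  - exact: (integrable_quantile_centered_sqr muG).
  - exact: integrable_sign_mul.
move=> ms ms'; apply: (correlation_scaled v0); first exact: cov.
- by rewrite cov// sign_corr_diag// mul1r.
- by rewrite cov// sign_corr_diag// mul1r.
Qed.

End Coupling.

Unset Implicit Arguments.

Theorem proposition4 (R : realType) (d : nat) (hd : (1 <= d)%N) (G : R -> R)
    (hG : concordance_inducing G) :
  bernoulli_correlation_matrices (2^-1 : R) d `<=` kappa_compatible G d.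
Proof.
move=> A [disp [T [P [B [lawB ->]]]]]; split.
  move=> i j; rewrite mxE correlation_bernoulli_half//.
  by rewrite -ler_norml norm_sign_corr//; exact/measurable_is_one/measurable_funPT.
have mB i : measurable_fun [set: T] (is_one (B i)) :=
  measurable_is_one (measurable_funPT (B i)).
pose X i : {mfun (T * R)%type >-> R} := HB.pack (flip (is_one (B i)))
  (isMeasurableFun.Build _ _ _ _ _ (measurable_flip (mB i))).
pose PP : probability (T * R)%type R := (P \x uniform01 R)%E.
have mX i : margin (X i : {RV PP >-> R}) = @clamp01 R by exact: margin_flip.
exists _, (T * R)%type, PP, X; split.
  by move=> i; rewrite mX; exact: continuous_clamp01.
apply/matrixP => i j; rewrite !mxE /kappa !mX correlation_bernoulli_half//.
by rewrite -(correlation_flip P hG).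
Qed.
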